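(* Let $p(t):=a_dt^d+\dots+a_1t+a_0$ be a polynomial such that $a_k\ge0$ for $k=0,\dots,d$. Let $\alpha,\beta\in\mathbb R$ with $\alpha\ge0$, $\beta>0$. For $k\in\mathbb N_0$ let $$h_k:=e^{-\alpha^2/\beta}\sum_{l=0}^{\min(k,\deg p)}\binom{k}{l}\,l!\,a_l,$$ and define the weight sequence $w=(w_k)_{k\ge0}$ by $w_k:=\mathbf 1_{\{h_k>0\}}h_k^{-1}$ (that is, $w_k=h_k^{-1}$ if $h_k>0$ and $w_k=0$ otherwise). Define $$k(x,y):=p\left(\left(\sqrt\beta x-\frac{\alpha}{\sqrt\beta}\right)\left(\sqrt\beta y-\frac{\alpha}{\sqrt\beta}\right)\right)e^{\beta xy-\alpha(x+y)}.$$ Then $k$ is a fully consistent kernel and is the reproducing kernel of the RKHS $$\mathcal H(k)=\left\{f:\mathbb R_+\to\mathbb R\ \middle|\ f(x)=\sum_{k=0}^\infty \mathbf 1_{\{h_k>0\}}\,b_k\left(x-\frac\alpha\beta\right)^k,\ \left\|(b_k)_{k\ge0}\right\|_{\ell^2_w}<\infty\right\},$$ where $b_k:=f^{(k)}(\alpha/\beta)/k!$, with inner product $$\langle f,g\rangle_{\mathcal H(k)}=\sum_{k=0}^\infty\frac{w_k}{\beta^kk!}f^{(k)}\left(\frac\alpha\beta\right)g^{(k)}\left(\frac\alpha\beta\right)$$ and induced norm $$\|f\|_{\mathcal H(k)}^2=\sum_{k=0}^\infty\frac{w_k}{\beta^kk!}\left|f^{(k)}\left(\frac\alpha\beta\r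ight)\right|^2.$$
   Context: $\ell^2(\mathbb R)$ is the Hilbert space of square-summable real sequences. For a sequence $w=(w_k)_{k\ge0}\subseteq\mathbb R_+$ (possibly not in $\ell^2(\mathbb R)$) and $f,g\in\ell^2(\mathbb R)$, the weighted product is $\langle f,g\rangle_{\ell^2_w}=\langle w\odot f,g\rangle_{\ell^2}=\langle f,w\odot g\rangle_{\ell^2}$, where $w\odot f=(w_kf_k)_{k\ge0}$, and the weighted norm is $\|f\|^2_{\ell^2_w}:=\langle f,f\rangle_{\ell^2_w}=\sum_k w_k|f_k|^2$. A kernel function on $\mathbb R_+$ is a symmetric function $k:\mathbb R_+\times\mathbb R_+\to\mathbb R$ such that for all $n$ and distinct $x_1,\dots,x_n\in\mathbb R_+$ the matrix $(k(x_i,x_j))_{i,j}$ is positive semidefinite. Writing $k_y:x\mapsto k(y,x)$, a kernel function is called fully consistent if for any $N\in\mathbb N$ and any $y_1,\dots,y_N\in\mathbb R_+$ there is a finite-dimensional space $V\subseteq C^1(\mathbb R_+,\mathbb R)$ with $\partial_x(V)\subseteq V$ and $k_{y_1},\dots,k_{y_N}\in V$. A reproducing kernel Hilbert space (RKHS) on a set $\mathcal X$ is a Hilbert space of functions on $\mathcal X$ with bounded point evaluations; its reproducing kernel $k$ satisfies $f(x)=\langle f,k(\cdot,x)\rangle$ for all $f$ in the space and $x\in\mathcal X$. (The letter $k$ denotes both the kernel and a summation index.)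
   Formalization: Membership in H(k) also requires that the stated norm series Σ w_k|f^(k)(α/β)|²/(β^k k!) converges; the condition on (b_k) in ℓ²_w alone admits functions of infinite norm, e.g. p=1, α=0, β=1, b_k=1/√(k!). *)

(* Defs.v *)
From Stdlib Require Import Reals List Factorial.
From Coquelicot Require Import Coquelicot.
Open Scope R_scope.

(** * Reproducing kernel Hilbert spaces of real functions on a set [X] *)

Section RKHS.
Context {X : Type}.

(* [sum_n u n] is the inclusive sum u 0 + ... + u n, so the points are
   x_0, ..., x_n. *)
Definition kernel_function (K : X -> X -> R) : Prop :=
  (forall x y, K x y = K y x) /\
  (forall (n : nat) (x : nat -> X),
     (forall i j, (i <= n)%nat -> (j <= n)%nat -> x i = x j -> i = j) ->
     forall c : nat -> R,
       0 <= sum_n (fun i => sum_n (fun j => c i * K (x i) (x j) * c j) n) n).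

Definition linear_subspace (H : (X -> R) -> Prop) : Prop :=
  H (fun _ => 0) /\
  (forall f g, H f -> H g -> H (fun x => f x + g x)) /\
  (forall (c : R) f, H f -> H (fun x => c * f x)).

Definition finite_dimensional (V : (X -> R) -> Prop) : Prop :=
  linear_subspace V /\
  exists (n : nat) (e : nat -> X -> R),
    (forall i, (i <= n)%nat -> V (e i)) /\
    (forall f, V f -> exists c : nat -> R,
       forall x, f x = sum_n (fun i => c i * e i x) n).

(* A function space is a carrier [H] with a form [ip]; the values of [ip]
   outside [H] are irrelevant. *)
Definition inner_product_on (H : (X -> R) -> Prop)
    (ip : (X -> R) -> (X -> R) -> R) : Prop :=
  (forall f g, H f -> H g -> ip f g = ip g f) /\
  (forall f g h, H f -> H g -> H h ->
     ip (fun x => f x + g x) h = ip f h + ip g h) /\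
  (forall c f g, H f -> H g -> ip (fun x => c * f x) g = c * ip f g) /\
  (forall f, H f -> 0 <= ip f f) /\
  (forall f, H f -> ip f f = 0 -> forall x, f x = 0).

Definition induced_norm (ip : (X -> R) -> (X -> R) -> R) (f : X -> R) : R :=
  sqrt (ip f f).

Definition complete_for (H : (X -> R) -> Prop)
    (ip : (X -> R) -> (X -> R) -> R) : Prop :=
  forall u : nat -> X -> R,
    (forall n, H (u n)) ->
    (forall eps, 0 < eps -> exists N, forall n m, (N <= n)%nat -> (N <= m)%nat ->
       induced_norm ip (fun x => u n x - u m x) < eps) ->
    exists f, H f /\
      forall eps, 0 < eps -> exists N, forall n, (N <= n)%nat ->
        induced_norm ip (fun x => u n x - f x) < eps.

Definition is_RKHS (H : (X -> R) -> Prop)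
    (ip : (X -> R) -> (X -> R) -> R) : Prop :=
  linear_subspace H /\ inner_product_on H ip /\ complete_for H ip /\
  (forall x, exists M, forall f, H f -> Rabs (f x) <= M * induced_norm ip f).

Definition is_reproducing_kernel (H : (X -> R) -> Prop)
    (ip : (X -> R) -> (X -> R) -> R) (K : X -> X -> R) : Prop :=
  (forall x, H (fun y => K y x)) /\
  (forall f x, H f -> f x = ip f (fun y => K y x)).

End RKHS.

(** * Calculus for functions on [0, +oo) *)

(* Only the values of [ext f] on [0, +oo) are used below: limits are taken
   within that set, hence are one-sided at the end point 0. *)
Definition ext (f : nonnegreal -> R) (y : R) : R :=
  f (mknonnegreal (Rmax 0 y) (Rmax_l 0 y)).

Definition is_derive_nonneg (f : nonnegreal -> R) (x : nonnegreal) (l : R) : Prop :=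
  D_in (ext f) (fun _ => l) (Rle 0) x.

(* Meaningful where the derivative exists, as for Coquelicot's [RInt]. *)
Definition Derive_nonneg (f : nonnegreal -> R) (x : nonnegreal) : R :=
  iota (is_derive_nonneg f x).

Definition Derive_n_nonneg (n : nat) (f : nonnegreal -> R) : nonnegreal -> R :=
  Nat.iter n Derive_nonneg f.

Definition C1_nonneg (f : nonnegreal -> R) : Prop :=
  exists f' : nonnegreal -> R,
    forall x : nonnegreal,
      is_derive_nonneg f x (f' x) /\ continue_in (ext f') (Rle 0) x.

Definition fully_consistent (K : nonnegreal -> nonnegreal -> R) : Prop :=
  kernel_function K /\
  forall ys : list nonnegreal,
    exists V : (nonnegreal -> R) -> Prop,
      finite_dimensional V /\
      (forall f, V f -> C1_nonneg f) /\
      (forall f, V f -> V (Derive_nonneg f)) /\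
      (forall y, In y ys -> V (fun x => K y x)).

Definition in_l2w (w b : nat -> R) : Prop :=
  ex_series (fun k => w k * Rabs (b k) ^ 2).

(** * The kernel and its Hilbert space *)

(* The polynomial a_d t^d + ... + a_0; the coefficient a_d may vanish. *)
Definition poly (a : nat -> R) (d : nat) (t : R) : R :=
  sum_n (fun l => a l * t ^ l) d.

(* Degree of [poly a d], with value 0 for the zero polynomial. *)
Fixpoint degree (a : nat -> R) (d : nat) : nat :=
  match d with
  | O => O
  | S d' => if Req_EM_T (a d) 0 then degree a d' else d
  end.

Section Space.
Variables (a : nat -> R) (d : nat) (alpha : nonnegreal) (beta : posreal).

Definition hcoef (k : nat) : R :=
  exp (- (alpha ^ 2 / beta)) *
  sum_n (fun l => Binomial.C k l * INR (fact l) * a l) (min k (degree a d)).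

Definition ind (k : nat) : R := if Rlt_dec 0 (hcoef k) then 1 else 0.

Definition weight (k : nat) : R := if Rlt_dec 0 (hcoef k) then / hcoef k else 0.

Definition kern (x y : nonnegreal) : R :=
  poly a d ((sqrt beta * x - alpha / sqrt beta) * (sqrt beta * y - alpha / sqrt beta))
  * exp (beta * x * y - alpha * (x + y)).

Definition center : nonnegreal :=
  mknonnegreal (alpha / beta)
    (Rdiv_le_0_compat alpha beta (cond_nonneg alpha) (cond_pos beta)).

Definition taylor_coef (f : nonnegreal -> R) (k : nat) : R :=
  Derive_n_nonneg k f center / INR (fact k).

Definition Hip_term (f g : nonnegreal -> R) (k : nat) : R :=
  weight k / (beta ^ k * INR (fact k))
  * Derive_n_nonneg k f center * Derive_n_nonneg k g center.

Definition Hip (f g : nonnegreal -> R) : R := Series (Hip_term f g).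

Definition Hnorm2_term (f : nonnegreal -> R) (k : nat) : R :=
  weight k / (beta ^ k * INR (fact k)) * Rabs (Derive_n_nonneg k f center) ^ 2.

(* The last clause, finiteness of the norm of the space, does not follow from
   the second one and cannot be dropped: the norm is the sum of
   w_k k!/beta^k |b_k|^2, not of w_k |b_k|^2.  For p = 1, alpha = 0, beta = 1,
   b_k = 1/sqrt(k!), the first two clauses hold and the norm is infinite.
   Conversely, the last clause implies the second. *)
Definition Hspace (f : nonnegreal -> R) : Prop :=
  (forall x : nonnegreal,
     is_series (fun k => ind k * taylor_coef f k * (x - alpha / beta) ^ k) (f x)) /\
  in_l2w weight (taylor_coef f) /\
  ex_series (Hnorm2_term f).

End Space.

(* Main.v *)
Require Import Defs.
From Stdlib Require Import Reals List Factorial Lra Lia.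
From Coquelicot Require Import Coquelicot.
Open Scope R_scope.

(** In the coordinates s = x - alpha/beta, t = y - alpha/beta the kernel is
    exp(-alpha^2/beta) p(beta s t) exp(beta s t) = sum_k c_k s^k t^k with
    c_k = h_k beta^k / k! >= 0.  It is therefore positive semidefinite, and the functions of
    H(k) correspond to the coefficient sequences (b_k) supported on {h_k > 0} with
    sum_k b_k^2 / c_k finite, which is a weighted l^2 space.  By Cauchy-Schwarz against
    (c_k s^k)_k every such sequence gives an everywhere convergent power series, and
    sum_k b_k (c_k s^k) / c_k = f(x) is the reproducing property.  For full consistency,
    every k(y, .) is a polynomial in s of degree at most deg p times an exponential, and
    spaces of such functions, as well as their finite sums, are closed under d/dx. *)

(** * Finite sums and nonnegative series *)

(* Coquelicot types its sums in the carrier of [R_AbelianMonoid], where [ring] finds no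
   ring structure. *)
Ltac ring_R := match goal with |- ?a = ?b => change (@eq R a b); ring end.

Lemma sum_n_Rext (u v : nat -> R) (n : nat) :
  (forall k, u k = v k) -> sum_n u n = sum_n v n.
Proof. exact (sum_n_ext u v n). Qed.

Lemma sum_n_Rext_loc (u v : nat -> R) (n : nat) :
  (forall k, (k <= n)%nat -> u k = v k) -> sum_n u n = sum_n v n.
Proof. exact (sum_n_ext_loc u v n). Qed.

Lemma sum_n_Rmult_r (u : nat -> R) (r : R) (n : nat) :
  sum_n (fun k => u k * r) n = sum_n u n * r.
Proof. exact (sum_n_mult_r r u n). Qed.

Lemma sum_n_Rmult_l (u : nat -> R) (r : R) (n : nat) :
  sum_n (fun k => r * u k) n = r * sum_n u n.
Proof. exact (sum_n_mult_l r u n). Qed.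

Lemma sum_n_Rplus (u v : nat -> R) (n : nat) :
  sum_n (fun k => u k + v k) n = sum_n u n + sum_n v n.
Proof. exact (sum_n_plus u v n). Qed.

Lemma sum_n_last (u : nat -> R) (n : nat) : sum_n u (S n) = sum_n u n + u (S n).
Proof. exact (sum_Sn u n). Qed.

Lemma sum_n_head (u : nat -> R) (n : nat) :
  sum_n u (S n) = u 0%nat + sum_n (fun k => u (S k)) n.
Proof.
  unfold sum_n; rewrite (sum_n_m_S u 0 n); apply (sum_Sn_m u 0 (S n)); lia.
Qed.

Lemma sum_n_single (u : nat -> R) (i n : nat) :
  (i <= n)%nat -> sum_n (fun j => (if Nat.eq_dec j i then 1 else 0) * u j) n = u i.
Proof.
  assert (S0 : forall n, (n < i)%nat ->
    sum_n (fun j => (if Nat.eq_dec j i then 1 else 0) * u j) n = 0).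
  { intros m Hm; rewrite (sum_n_Rext_loc _ (fun j => 0 * u j)).
    - rewrite sum_n_Rmult_l; ring_R.
    - intros j Hj; destruct (Nat.eq_dec j i); [lia|reflexivity]. }
  intro Hi; induction Hi as [|n Hi IH].
  - destruct i as [|i]; [rewrite sum_O; apply Rmult_1_l|].
    rewrite sum_n_last, S0 by lia.
    destruct (Nat.eq_dec (S i) (S i)); [ring_R|lia].
  - rewrite sum_n_last, IH.
    destruct (Nat.eq_dec (S n) i); [lia|ring_R].
Qed.

Lemma ex_series_bounded_nonneg (u : nat -> R) (M : R) :
  (forall k, 0 <= u k) -> (forall n, sum_n u n <= M) ->
  ex_series u /\ Series u <= M.
Proof.
  intros u_pos u_le.
  destruct (ex_finite_lim_seq_incr (sum_n u) M) as [l Hl]; [|exact u_le|].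
  { intro n; rewrite sum_Sn; unfold plus; simpl; specialize (u_pos (S n)); lra. }
  assert (Hs : is_series u l) by exact Hl.
  split; [exists l; exact Hs|].
  rewrite (is_series_unique _ _ Hs).
  exact (is_lim_seq_le _ _ l M u_le Hl (is_lim_seq_const M)).
Qed.

Lemma sum_n_nonneg (u : nat -> R) (n : nat) :
  (forall k, 0 <= u k) -> 0 <= sum_n u n.
Proof.
  intros u_pos; induction n as [|n IH]; [rewrite sum_O; auto|].
  rewrite sum_Sn; unfold plus; simpl; specialize (u_pos (S n)); lra.
Qed.

Lemma Series_nonneg (u : nat -> R) :
  (forall k, 0 <= u k) -> ex_series u -> 0 <= Series u.
Proof.
  intros u_pos Hu; apply Series_correct in Hu.
  refine (is_lim_seq_le (fun _ => 0) (sum_n u) 0 (Series u) _ (is_lim_seq_const 0) Hu).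
  intro n; apply sum_n_nonneg, u_pos.
Qed.

Lemma sum_n_le_Series (u : nat -> R) (n : nat) :
  (forall k, 0 <= u k) -> ex_series u -> sum_n u n <= Series u.
Proof.
  intros u_pos Hu; apply Series_correct in Hu.
  refine (is_lim_seq_incr_compare (sum_n u) (Series u) Hu _ n).
  intro m; rewrite sum_Sn; unfold plus; simpl; specialize (u_pos (S m)); lra.
Qed.

Lemma term_le_Series (u : nat -> R) (n : nat) :
  (forall k, 0 <= u k) -> ex_series u -> u n <= Series u.
Proof.
  intros u_pos Hu; apply Rle_trans with (2 := sum_n_le_Series u n u_pos Hu).
  destruct n as [|n]; [rewrite sum_O; lra|].
  rewrite sum_Sn; unfold plus; simpl.
  pose proof (sum_n_nonneg u n u_pos); lra.
Qed.

Lemma ex_series_Rle (u v : nat -> R) :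
  (forall k, Rabs (u k) <= v k) -> ex_series v -> ex_series u.
Proof. exact (ex_series_le u v). Qed.

(** * Weighted square-summable sequences *)

Section WeightedL2.
Variable W : nat -> R.
Hypothesis W_pos : forall k, 0 <= W k.

Definition l2_finite (b : nat -> R) : Prop := ex_series (fun k => W k * b k ^ 2).

Lemma l2_term_pos (b : nat -> R) (k : nat) : 0 <= W k * b k ^ 2.
Proof. apply Rmult_le_pos; [apply W_pos|apply pow2_ge_0]. Qed.

Lemma l2_finite_ext (b b' : nat -> R) :
  (forall k, b k = b' k) -> l2_finite b -> l2_finite b'.
Proof. intros E; apply ex_series_ext; intro k; rewrite E; reflexivity. Qed.

Lemma l2_finite_scal (c : R) (b : nat -> R) :
  l2_finite b -> l2_finite (fun k => c * b k).
Proof.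
  intro Hb.
  apply ex_series_ext with (fun k => scal (c ^ 2) (W k * b k ^ 2)).
  { intro k; unfold scal; simpl; unfold mult; simpl; ring. }
  exact (ex_series_scal (c ^ 2) _ Hb).
Qed.

(** A common majorant: both [(b k + b' k) ^ 2] and [Rabs (b k * b' k)] are at most
    [2 * (b k ^ 2 + b' k ^ 2)], so sums and products converge by comparison. *)
Lemma ex_series_l2_sum (b b' : nat -> R) :
  l2_finite b -> l2_finite b' ->
  ex_series (fun k => 2 * (W k * b k ^ 2 + W k * b' k ^ 2)).
Proof.
  intros Hb Hb'; exact (ex_series_scal 2 _ (ex_series_plus _ _ Hb Hb')).
Qed.

Lemma l2_finite_plus (b b' : nat -> R) :
  l2_finite b -> l2_finite b' -> l2_finite (fun k => b k + b' k).
Proof.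
  intros Hb Hb'.
  apply ex_series_Rle with (2 := ex_series_l2_sum b b' Hb Hb').
  intro k; rewrite Rabs_pos_eq by apply (l2_term_pos (fun k => b k + b' k)).
  pose proof (W_pos k) as Wk; pose proof (pow2_ge_0 (b k - b' k)); nra.
Qed.

Lemma ex_series_l2_prod (b b' : nat -> R) :
  l2_finite b -> l2_finite b' -> ex_series (fun k => W k * b k * b' k).
Proof.
  intros Hb Hb'.
  apply ex_series_Rle with (2 := ex_series_l2_sum b b' Hb Hb').
  intro k; pose proof (W_pos k) as Wk.
  pose proof (Rmult_le_pos _ _ Wk (pow2_ge_0 (b k - b' k))).
  pose proof (Rmult_le_pos _ _ Wk (pow2_ge_0 (b k + b' k))).
  pose proof (l2_term_pos b k); pose proof (l2_term_pos b' k).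
  apply Rabs_le; split; nra.
Qed.

(** The limit is taken coordinatewise, then the Cauchy bound is passed to it through partial sums.
    The form does not see coordinates with [W k = 0], so these are required to vanish. *)
Lemma l2_complete (b : nat -> nat -> R) :
  (forall n, l2_finite (b n)) ->
  (forall n k, W k = 0 -> b n k = 0) ->
  (forall eps, 0 < eps -> exists N, forall n m, (N <= n)%nat -> (N <= m)%nat ->
     Series (fun k => W k * (b n k - b m k) ^ 2) <= eps) ->
  exists b' : nat -> R,
    l2_finite b' /\ (forall k, W k = 0 -> b' k = 0) /\
    forall eps, 0 < eps -> exists N, forall n, (N <= n)%nat ->
      Series (fun k => W k * (b n k - b' k) ^ 2) <= eps.
Proof.
  intros Hb Hb0 Hcauchy.
  assert (Hdiff : forall n m, l2_finite (fun k => b n k - b m k)).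
  { intros n m; apply l2_finite_ext with (fun k => b n k + -1 * b m k); [intro; ring|].
    apply l2_finite_plus; [apply Hb|apply l2_finite_scal, Hb]. }
  assert (Hlim : forall k, exists l, is_lim_seq (fun n => b n k) (Finite l)).
  { intro k; destruct (Req_dec (W k) 0) as [W0|W0].
    - exists 0; apply is_lim_seq_ext with (fun _ => 0); [|apply is_lim_seq_const].
      intro n; rewrite Hb0; auto.
    - assert (W1 : 0 < W k) by (pose proof (W_pos k) as Wk; lra).
      apply ex_lim_seq_cauchy_corr; intros [eps Heps]; simpl.
      (* A single term is at most the whole sum, so this threshold gives
         [Rabs (b n k - b m k) <= eps / 2] after division by [W k]. *)
      destruct (Hcauchy (W k * (eps / 2) ^ 2)) as [N HN].
      { apply Rmult_lt_0_compat; [exact W1|apply pow_lt; lra]. }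
      exists N; intros n m Hn Hm.
      pose proof (term_le_Series _ k (l2_term_pos (fun k => b n k - b m k)) (Hdiff n m)) as T.
      simpl in T; specialize (HN n m Hn Hm).
      assert (Hsq : (b n k - b m k) ^ 2 <= (eps / 2) ^ 2).
      { apply Rmult_le_reg_l with (W k); [exact W1|]. simpl in *; lra. }
      rewrite <- !Rsqr_pow2 in Hsq; apply Rsqr_le_abs_0 in Hsq.
      rewrite (Rabs_pos_eq (eps / 2)) in Hsq by lra.
      lra. }
  set (b' := fun k => real (Lim_seq (fun n => b n k))).
  assert (Hb' : forall k, is_lim_seq (fun n => b n k) (b' k)).
  { intro k; destruct (Hlim k) as [l Hl]; unfold b'.
    rewrite (is_lim_seq_unique _ _ Hl); exact Hl. }
  clearbody b'; clear Hlim.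
  (* Fatou-style argument: for a fixed cut-off [K] the partial sum is at most [eps] for all
     [m >= N]. Letting [m] tend to infinity keeps the bound, and it is uniform in [K]. *)
  assert (Hball : forall eps, 0 < eps -> exists N, forall n, (N <= n)%nat ->
     l2_finite (fun k => b n k - b' k) /\
      Series (fun k => W k * (b n k - b' k) ^ 2) <= eps).
  { intros eps Heps; destruct (Hcauchy eps Heps) as [N HN]; exists N; intros n Hn.
    apply ex_series_bounded_nonneg.
    { apply (l2_term_pos (fun k => b n k - b' k)). }
    intro K.
    assert (HK : is_lim_seq (fun m => sum_n (fun k => W k * (b n k - b m k) ^ 2) K)
                  (sum_n (fun k => W k * (b n k - b' k) ^ 2) K)).
    { assert (Hk : forall k, is_lim_seq (fun m => W k * (b n k - b m k) ^ 2)
                 (W k * (b n k - b' k) ^ 2)).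
      { intro k; simpl.
        assert (D : is_lim_seq (fun m => b n k - b m k) (b n k - b' k)).
        { apply is_lim_seq_minus'; [apply is_lim_seq_const|apply Hb']. }
        apply is_lim_seq_mult'; [apply is_lim_seq_const|].
        apply is_lim_seq_mult'; [exact D|].
        apply is_lim_seq_mult'; [exact D|apply is_lim_seq_const]. }
      induction K as [|K IH].
      - rewrite sum_O; eapply is_lim_seq_ext; [|apply (Hk 0%nat)].
        intro m; rewrite sum_O; reflexivity.
      - rewrite sum_Sn; eapply is_lim_seq_ext;
          [|apply is_lim_seq_plus'; [exact IH|apply (Hk (S K))]].
        intro m; rewrite sum_Sn; reflexivity. }
    refine (is_lim_seq_le_loc _ (fun _ => eps) _ (Finite eps) _ HK (is_lim_seq_const eps)).
    exists N; intros m Hm; apply Rle_trans with (2 := HN n m Hn Hm).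
    apply (sum_n_le_Series (fun k => W k * (b n k - b m k) ^ 2)).
    - apply (l2_term_pos (fun k => b n k - b m k)).
    - apply Hdiff. }
  exists b'; split; [|split].
  (* The limit is square-summable as [b N] minus the square-summable difference [b N - b']. *)
  - destruct (Hball 1 Rlt_0_1) as [N HN]; destruct (HN N (Nat.le_refl N)) as [HN' _].
    apply l2_finite_ext with (fun k => b N k + -1 * (b N k - b' k)); [intro; ring|].
    apply l2_finite_plus; [apply Hb|apply (l2_finite_scal _ _ HN')].
  - intros k W0; pose proof (Hb' k) as L.
    assert (L0 : is_lim_seq (fun n => b n k) 0).
    { apply is_lim_seq_ext with (fun _ => 0); [|apply is_lim_seq_const].
      intro n; rewrite Hb0; auto. }
    apply is_lim_seq_unique in L; apply is_lim_seq_unique in L0.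
    rewrite L in L0; injection L0; auto.
  - intros eps Heps; destruct (Hball eps Heps) as [N HN]; exists N; intros n Hn.
    apply (HN n Hn).
Qed.

End WeightedL2.

(** * Derivatives on the half-line *)

(** On nonnegative points the [Rmax] in [ext] disappears, so the one-sided difference quotients of
    [f] are among the two-sided ones of [F]. *)
Lemma is_derive_nonneg_restr (F : R -> R) (f : nonnegreal -> R) (x : nonnegreal) (l : R) :
  (forall y : nonnegreal, f y = F y) -> is_derive F x l -> is_derive_nonneg f x l.
Proof.
  intros E HF; apply is_derive_Reals in HF.
  intros eps Heps; destruct (HF eps Heps) as [[delta Hdelta] H]; simpl in H.
  exists delta; split; [exact Hdelta|].
  intros y [[Hy Hne] Hdist]; simpl in *; unfold Rdist in *.
  specialize (H (y - x)).
  replace (x + (y - x)) with y in H by ring.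
  unfold ext; rewrite !E; simpl.
  rewrite !Rmax_right by (try apply cond_nonneg; exact Hy).
  apply H; [lra|exact Hdist].
Qed.

Lemma is_derive_nonneg_unique (f : nonnegreal -> R) (x : nonnegreal) (l l' : R) :
  is_derive_nonneg f x l -> is_derive_nonneg f x l' -> l = l'.
Proof.
  (* Moving to the right stays in the half-line, so every point is a limit point, the end point 0
     included. *)
  apply single_limit; intros eps Heps; exists (x + eps / 2).
  destruct x as [x Hx]; unfold D_x, Rdist; simpl.
  split; [lra|rewrite Rabs_pos_eq; lra].
Qed.

Lemma Derive_nonneg_eq (f : nonnegreal -> R) (x : nonnegreal) (l : R) :
  is_derive_nonneg f x l -> Derive_nonneg f x = l.
Proof.
  intro H; apply (iota_unique (is_derive_nonneg f x)); [|exact H].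
  intros y Hy; exact (is_derive_nonneg_unique f x y l Hy H).
Qed.

Lemma Derive_n_nonneg_restr (F : R -> R) (f : nonnegreal -> R) :
  (forall y : nonnegreal, f y = F y) -> (forall n y, ex_derive_n F n y) ->
  forall n (y : nonnegreal), Derive_n_nonneg n f y = Derive_n F n y.
Proof.
  intros E HF n; induction n as [|n IH]; intro y; [exact (E y)|].
  apply Derive_nonneg_eq, (is_derive_nonneg_restr (Derive_n F n)); [exact IH|].
  apply Derive_correct, (HF (S n)).
Qed.

Definition expansion (c : R) (f : nonnegreal -> R) (b : nat -> R) : Prop :=
  forall x : nonnegreal, is_series (fun k => b k * (x - c) ^ k) (f x).

(** The half-line reaches arbitrarily far from [c], so convergence on it excludes a finite
    radius. *)
Lemma expansion_radius (c : R) (f : nonnegreal -> R) (b : nat -> R) :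
  expansion c f b -> CV_radius b = p_infty.
Proof.
  intro H; pose proof (CV_radius_ge_0 b) as R0.
  destruct (CV_radius b) as [r| |] eqn:Er; [|reflexivity|destruct R0].
  exfalso; simpl in R0.
  (* This point is nonnegative and its distance from [c] is at least [r + 1]. *)
  assert (Hx : 0 <= Rabs c + r + 1) by (pose proof (Rabs_pos c); lra).
  specialize (H (mknonnegreal _ Hx)); simpl in H.
  apply (CV_disk_outside b (Rabs c + r + 1 - c)).
  - rewrite Er; simpl; apply Rlt_le_trans with (2 := Rle_abs _).
    pose proof (Rle_abs c); lra.
  - apply ex_series_lim_0; eexists; exact H.
Qed.

(** With infinite radius the series is a smooth function on the whole line extending [f]. Its
    two-sided derivatives at [c] then give the half-line ones, even when [c] is 0. *)
Lemma Derive_n_nonneg_expansion (c : nonnegreal) (f : nonnegreal -> R) (b : nat -> R) :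
  expansion c f b -> forall n, Derive_n_nonneg n f c = b n * INR (fact n).
Proof.
  intros H n; pose proof (expansion_radius c f b H) as Hr.
  rewrite (Derive_n_nonneg_restr (fun x => PSeries b (x + - c))).
  - rewrite Derive_n_comp_trans, Rplus_opp_r.
    apply Derive_n_coef; rewrite Hr; exact I.
  - intro y; symmetry; apply is_series_unique.
    eapply is_series_ext; [|apply (H y)]; intro k; simpl; reflexivity.
  - intros m y; apply ex_derive_n_comp_trans, ex_derive_n_PSeries; rewrite Hr; exact I.
Qed.

(** * Finite-dimensional spaces closed under differentiation *)

Lemma is_derive_nonneg_ext (f g : nonnegreal -> R) (x : nonnegreal) (l : R) :
  (forall y, f y = g y) -> is_derive_nonneg f x l -> is_derive_nonneg g x l.
Proof.
  intros E H eps Heps; destruct (H eps Heps) as [delta [Hdelta Hd]].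
  exists delta; split; [exact Hdelta|].
  intros y Hy; unfold ext; rewrite <- !E; exact (Hd y Hy).
Qed.

Lemma is_derive_nonneg_plus (f g : nonnegreal -> R) (x : nonnegreal) (l m : R) :
  is_derive_nonneg f x l -> is_derive_nonneg g x m ->
  is_derive_nonneg (fun y => f y + g y) x (l + m).
Proof.
  exact (Dadd (Rle 0) (fun _ => l) (fun _ => m) (ext f) (ext g) x).
Qed.

Definition derivation_closed (V : (nonnegreal -> R) -> Prop) : Prop :=
  finite_dimensional V /\ (forall f, V f -> C1_nonneg f) /\
  forall f, V f -> V (Derive_nonneg f).

Definition sum_space (V W : (nonnegreal -> R) -> Prop) (f : nonnegreal -> R) : Prop :=
  exists g h, V g /\ W h /\ forall x, f x = g x + h x.

Lemma sum_space_l (V W : (nonnegreal -> R) -> Prop) (f : nonnegreal -> R) :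
  linear_subspace W -> V f -> sum_space V W f.
Proof.
  intros [W0 _] Vf; exists f, (fun _ => 0); repeat split; auto; intro; ring_R.
Qed.

Lemma sum_space_r (V W : (nonnegreal -> R) -> Prop) (f : nonnegreal -> R) :
  linear_subspace V -> W f -> sum_space V W f.
Proof.
  intros [V0 _] Wf; exists (fun _ => 0), f; repeat split; auto; intro; ring_R.
Qed.

Lemma linear_subspace_sum (V W : (nonnegreal -> R) -> Prop) :
  linear_subspace V -> linear_subspace W -> linear_subspace (sum_space V W).
Proof.
  intros HV HW; split; [|split].
  - apply sum_space_l; [exact HW|apply HV].
  - intros f f' [g [h [Hg [Hh E]]]] [g' [h' [Hg' [Hh' E']]]].
    exists (fun x => g x + g' x), (fun x => h x + h' x).
    split; [apply HV; assumption|split; [apply HW; assumption|]].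
    intro x; rewrite E, E'; ring_R.
  - intros c f [g [h [Hg [Hh E]]]].
    exists (fun x => c * g x), (fun x => c * h x).
    split; [apply HV; assumption|split; [apply HW; assumption|]].
    intro x; rewrite E; ring_R.
Qed.

Lemma finite_dimensional_sum (V W : (nonnegreal -> R) -> Prop) :
  finite_dimensional V -> finite_dimensional W -> finite_dimensional (sum_space V W).
Proof.
  intros [HV [n [e [Ve He]]]] [HW [m [e' [We He']]]].
  split; [apply linear_subspace_sum; assumption|].
  (* Concatenation of the two spanning families. Index bounds are inclusive: [n + 1] entries come
     from [u] and [m + 1] from [v], so the last index is [S n + m]. *)
  set (join := fun (A : Type) (u v : nat -> A) i =>
         if Compare_dec.le_lt_dec i n then u i else v (i - S n)%nat).
  assert (Hjoin : forall (u v : nat -> R),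
            sum_n (join R u v) (S n + m) = sum_n u n + sum_n v m).
  { intros u v; unfold sum_n at 1.
    rewrite (sum_n_m_Chasles _ 0 n (S n + m)) by lia.
    unfold plus; simpl; f_equal.
    - apply sum_n_ext_loc; intros k Hk; unfold join.
      destruct (Compare_dec.le_lt_dec k n); [reflexivity|lia].
    - unfold sum_n; clear; induction m as [|m IH].
      + rewrite Nat.add_0_r, !sum_n_n; unfold join.
        destruct (Compare_dec.le_lt_dec (S n) n); [lia|f_equal; lia].
      + rewrite Nat.add_succ_r, (sum_n_Sm _ (S n)), (sum_n_Sm _ 0) by lia.
        rewrite IH; f_equal.
        unfold join; destruct (Compare_dec.le_lt_dec (S (S (n + m))) n); [lia|].
        f_equal; lia. }
  exists (S n + m)%nat, (join _ e e'); split.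
  - intros i Hi; unfold join; destruct (Compare_dec.le_lt_dec i n).
    + apply sum_space_l; auto.
    + apply sum_space_r; [assumption|apply We; lia].
  - intros f [g [h [Hg [Hh E]]]].
    destruct (He g Hg) as [u Hu], (He' h Hh) as [v Hv].
    exists (join R u v); intro x; rewrite E, Hu, Hv, <- Hjoin.
    apply sum_n_Rext; intro i; unfold join.
    destruct (Compare_dec.le_lt_dec i n); reflexivity.
Qed.

Lemma C1_nonneg_Derive (f : nonnegreal -> R) (x : nonnegreal) :
  C1_nonneg f -> is_derive_nonneg f x (Derive_nonneg f x).
Proof.
  intros [f' Hf']; destruct (Hf' x) as [D _].
  rewrite (Derive_nonneg_eq _ _ _ D); exact D.
Qed.

Lemma derivation_closed_sum (V W : (nonnegreal -> R) -> Prop) :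
  derivation_closed V -> derivation_closed W -> derivation_closed (sum_space V W).
Proof.
  intros [FV [CV DV]] [FW [CW DW]]; split; [|split].
  - apply finite_dimensional_sum; assumption.
  - intros f [g [h [Hg [Hh E]]]].
    destruct (CV g Hg) as [g' Hg'], (CW h Hh) as [h' Hh'].
    exists (fun x => g' x + h' x); intro x.
    destruct (Hg' x) as [G1 G2], (Hh' x) as [H1 H2]; split.
    + apply is_derive_nonneg_ext with (fun y => g y + h y); [intro; auto|].
      apply is_derive_nonneg_plus; assumption.
    + exact (limit_plus _ _ _ _ _ _ G2 H2).
  - intros f [g [h [Hg [Hh E]]]].
    exists (Derive_nonneg g), (Derive_nonneg h); split; [auto|split; [auto|]].
    intro x; apply Derive_nonneg_eq.
    apply is_derive_nonneg_ext with (fun y => g y + h y); [intro; auto|].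
    apply is_derive_nonneg_plus; apply C1_nonneg_Derive; auto.
Qed.

Definition exp_poly_space (d : nat) (c lambda : R) (f : nonnegreal -> R) : Prop :=
  exists q : nat -> R, forall x : nonnegreal,
    f x = sum_n (fun j => q j * (x - c) ^ j) d * exp (lambda * x).

Lemma is_derive_poly (d : nat) (c : R) (q : nat -> R) :
  exists q' : nat -> R, forall x,
    is_derive (fun x => sum_n (fun j => q j * (x - c) ^ j) d) x
              (sum_n (fun j => q' j * (x - c) ^ j) d).
Proof.
  (* The top coefficient is padded with 0, which keeps the same index range [0..d]. *)
  exists (fun j => if Compare_dec.lt_dec j d then INR (S j) * q (S j) else 0); intro x.
  replace (sum_n _ d) with (sum_n (fun j => INR j * q j * (x - c) ^ pred j) d).
  - apply (is_derive_sum_n (fun j x => q j * (x - c) ^ j)); intros k _.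
    auto_derive; [exact I|]; simpl; unfold Rminus; ring_R.
  - destruct d as [|d]; [rewrite !sum_O; simpl; ring_R|].
    rewrite sum_n_head, sum_n_last.
    destruct (Compare_dec.lt_dec (S d) (S d)) as [L|_]; [lia|].
    simpl INR at 1; rewrite !Rmult_0_l, Rplus_0_l, Rplus_0_r.
    apply sum_n_ext_loc; intros k Hk.
    destruct (Compare_dec.lt_dec k (S d)); [reflexivity|lia].
Qed.

Lemma derivation_closed_exp_poly (d : nat) (c lambda : R) :
  derivation_closed (exp_poly_space d c lambda).
Proof.
  (* By the product rule, differentiation turns the polynomial factor [q] into [q' + lambda * q],
     whose degree is again at most [d]. *)
  assert (D : forall f, exp_poly_space d c lambda f ->
    exists f', exp_poly_space d c lambda f' /\ forall x, is_derive_nonneg f x (f' x)).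
  { intros f [q Hq]; destruct (is_derive_poly d c q) as [q' Hq'].
    exists (fun x => sum_n (fun j => (q' j + lambda * q j) * (x - c) ^ j) d
                     * exp (lambda * x)).
    split; [eexists; intro; reflexivity|].
    intro x.
    apply (is_derive_nonneg_restr
      (fun x => sum_n (fun j => q j * (x - c) ^ j) d * exp (lambda * x))); [exact Hq|].
    replace (sum_n (fun j => (q' j + lambda * q j) * (x - c) ^ j) d)
      with (sum_n (fun j => q' j * (x - c) ^ j) d
            + lambda * sum_n (fun j => q j * (x - c) ^ j) d).
    - assert (E : is_derive (fun y => exp (lambda * y)) (x : R) (lambda * exp (lambda * x))).
      { auto_derive; [exact I|ring_R]. }
      evar_last; [exact (is_derive_mult _ _ _ _ _ (Hq' x) E Rmult_comm)|].
      unfold plus, mult; simpl; ring_R.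
    - rewrite <- sum_n_Rmult_l, <- sum_n_Rplus.
      apply sum_n_Rext; intro; ring_R. }
  split; [|split].
  - split; [split; [|split]|].
    + exists (fun _ => 0); intro x.
      rewrite sum_n_Rmult_l; ring_R.
    + intros f g [q Hq] [r Hr]; exists (fun j => q j + r j); intro x.
      rewrite Hq, Hr, <- Rmult_plus_distr_r, <- sum_n_Rplus; f_equal.
      apply sum_n_Rext; intro; ring_R.
    + intros t f [q Hq]; exists (fun j => t * q j); intro x.
      rewrite Hq, <- Rmult_assoc, <- sum_n_Rmult_l; f_equal.
      apply sum_n_Rext; intro; ring_R.
    + exists d, (fun i x => (x - c) ^ i * exp (lambda * x)); split.
      * intros i Hi; exists (fun j => if Nat.eq_dec j i then 1 else 0); intro x.
        rewrite (sum_n_single (fun j => (x - c) ^ j) i d Hi); reflexivity.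
      * intros f [q Hq]; exists q; intro x; rewrite Hq, <- sum_n_Rmult_r.
        apply sum_n_Rext; intro; ring_R.
  (* The derivative lies in the space too, so it is differentiable and hence continuous. *)
  - intros f Hf; destruct (D f Hf) as [f' [Hf' F]]; destruct (D f' Hf') as [f'' [_ F']].
    exists f'; intro x; split; [apply F|exact (cont_deriv _ _ _ _ (F' x))].
  - intros f Hf; destruct (D f Hf) as [f' [[q' Hq'] F]].
    exists q'; intro x; rewrite <- Hq'; apply Derive_nonneg_eq, F.
Qed.

(** * Power series expansion of the kernel *)

Lemma is_series_sum_n (u : nat -> nat -> R) (s : nat -> R) (n : nat) :
  (forall l, is_series (u l) (s l)) ->
  is_series (fun k => sum_n (fun l => u l k) n) (sum_n s n).
Proof.
  intro H; induction n as [|n IH].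
  - rewrite sum_O; apply is_series_ext with (2 := H 0%nat).
    intro k; rewrite sum_O; reflexivity.
  - rewrite sum_Sn; apply is_series_ext with (2 := is_series_plus _ _ _ _ IH (H (S n))).
    intro k; rewrite sum_Sn; reflexivity.
Qed.

Lemma is_series_Rscal (r : R) (u : nat -> R) (s : R) :
  is_series u s -> is_series (fun k => r * u k) (r * s).
Proof. exact (is_series_scal r u s). Qed.

Lemma is_series_Rplus (u v : nat -> R) (s t : R) :
  is_series u s -> is_series v t -> is_series (fun k => u k + v k) (s + t).
Proof. exact (is_series_plus u v s t). Qed.

Lemma is_series_exp (u : R) : is_series (fun k => u ^ k / INR (fact k)) (exp u).
Proof.
  apply is_series_ext with (2 := is_exp_Reals u).
  intro k; rewrite pow_n_pow; reflexivity.
Qed.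

(** The exponential series shifted by [l] places. *)
Lemma is_series_pow_mult_exp (u : R) (l : nat) :
  is_series (fun k => if Compare_dec.le_lt_dec l k then u ^ k / INR (fact (k - l)) else 0)
            (u ^ l * exp u).
Proof.
  pose proof (is_pseries_incr_n _ l _ _ (is_exp_Reals u)) as H.
  rewrite pow_n_pow in H; apply is_series_ext with (2 := H).
  intro k; rewrite PS_incr_n_simplify, pow_n_pow; unfold scal, mult, zero; simpl.
  destruct (Compare_dec.le_lt_dec l k); [reflexivity|apply Rmult_0_r].
Qed.

Lemma sum_n_min (v : nat -> R) (k n : nat) :
  sum_n (fun l => if Compare_dec.le_lt_dec l k then v l else 0) n = sum_n v (min k n).
Proof.
  induction n as [|n IH].
  - rewrite Nat.min_0_r, !sum_O; reflexivity.
  - rewrite sum_n_last, IH; destruct (Compare_dec.le_lt_dec (S n) k) as [L|L].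
    + rewrite !Nat.min_r by lia; rewrite sum_n_last; reflexivity.
    + rewrite !Nat.min_l by lia; ring_R.
Qed.

(** The monomial [a l * u ^ l] contributes [a l / (k - l)!] to the coefficient of [u ^ k] when
    [l <= k], and [1 / (k - l)! = C(k, l) * l! / k!]. This is where the sum in [hcoef] and its bound
    [min k n] come from. *)
Lemma is_series_poly_mult_exp (a : nat -> R) (n : nat) (u : R) :
  is_series (fun k => sum_n (fun l => Binomial.C k l * INR (fact l) * a l) (min k n)
                      / INR (fact k) * u ^ k)
            (sum_n (fun l => a l * u ^ l) n * exp u).
Proof.
  rewrite <- sum_n_Rmult_r.
  eapply is_series_ext; [|apply is_series_sum_n].
  2: { intro l; rewrite Rmult_assoc.
       exact (is_series_Rscal (a l) _ _ (is_series_pow_mult_exp u l)). }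
  intro k; simpl; unfold Rdiv; rewrite Rmult_assoc, <- sum_n_Rmult_r, <- sum_n_min.
  apply sum_n_Rext; intro l.
  destruct (Compare_dec.le_lt_dec l k) as [L|L]; [|ring_R].
  unfold Binomial.C; field; repeat split; apply INR_fact_neq_0.
Qed.

Lemma poly_degree (a : nat -> R) (d : nat) (t : R) :
  Defs.poly a d t = sum_n (fun l => a l * t ^ l) (degree a d).
Proof.
  unfold Defs.poly; induction d as [|d IH]; [reflexivity|].
  simpl degree; destruct (Req_EM_T (a (S d)) 0) as [E|E]; [|reflexivity].
  rewrite sum_n_last, E, IH; ring_R.
Qed.

Lemma degree_le (a : nat -> R) (d : nat) : (degree a d <= d)%nat.
Proof.
  induction d as [|d IH]; simpl; [lia|destruct (Req_EM_T (a (S d)) 0); lia].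
Qed.

(** * Kernel coefficients, positive semidefiniteness and full consistency *)

Section Kernel.
Variables (a : nat -> R) (d : nat) (alpha : nonnegreal) (beta : posreal).
Hypothesis a_pos : forall k, (k <= d)%nat -> 0 <= a k.

Notation h := (hcoef a d alpha beta).
Notation K := (kern a d alpha beta).
Notation c := (alpha / beta).

(** The weight of the squared Taylor coefficient in the norm: derivatives are [k!] times Taylor
    coefficients, so [w_k / (beta^k k!)] becomes [w_k k! / beta^k]. *)
Definition norm_weight (k : nat) : R :=
  weight a d alpha beta k * (INR (fact k) / beta ^ k).

Definition kernel_coef (k : nat) : R := h k * (beta ^ k / INR (fact k)).

Notation W := norm_weight.

Lemma hcoef_nonneg (k : nat) : 0 <= h k.
Proof.
  apply Rmult_le_pos; [left; apply exp_pos|].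
  assert (Hm : (min k (degree a d) <= d)%nat) by (pose proof (degree_le a d); lia).
  (* The sign of [a l] is known only for [l <= d], while [sum_n_nonneg] wants every term
     nonnegative; the terms beyond [d] are set to 0. *)
  rewrite (sum_n_Rext_loc _ (fun l => if Compare_dec.le_lt_dec l d
    then Binomial.C k l * INR (fact l) * a l else 0)).
  - apply sum_n_nonneg; intro l; destruct (Compare_dec.le_lt_dec l d) as [L|L]; [|lra].
    apply Rmult_le_pos; [|auto].
    apply Rmult_le_pos; [|apply pos_INR].
    unfold Binomial.C; apply Rdiv_le_0_compat; [apply pos_INR|].
    apply Rmult_lt_0_compat; apply INR_fact_lt_0.
  - intros l Hl; destruct (Compare_dec.le_lt_dec l d); [reflexivity|lia].
Qed.

Lemma fact_div_pow_pos (k : nat) : 0 < INR (fact k) / beta ^ k.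
Proof. apply Rdiv_lt_0_compat; [apply INR_fact_lt_0|apply pow_lt, cond_pos]. Qed.

(** The dichotomy behind all later termwise identities: either everything at index [k] vanishes, or
    [norm_weight] and [kernel_coef] are reciprocal. *)
Lemma norm_weight_cases (k : nat) :
  (h k = 0 /\ W k = 0 /\ kernel_coef k = 0 /\ Defs.ind a d alpha beta k = 0) \/
  (0 < W k /\ W k * kernel_coef k = 1 /\ Defs.ind a d alpha beta k = 1).
Proof.
  unfold norm_weight, kernel_coef, weight, Defs.ind.
  pose proof (fact_div_pow_pos k) as Hf.
  destruct (Rlt_dec 0 (h k)) as [L|L].
  - right; split; [|split; [|reflexivity]].
    + apply Rmult_lt_0_compat; [apply Rinv_0_lt_compat, L|exact Hf].
    + field; repeat split; [apply INR_fact_neq_0| |lra].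
      apply pow_nonzero, Rgt_not_eq, cond_pos.
  - left; pose proof (hcoef_nonneg k); assert (E : h k = 0) by lra.
    rewrite E; repeat split; ring.
Qed.

Lemma norm_weight_nonneg (k : nat) : 0 <= W k.
Proof. destruct (norm_weight_cases k) as [[_ [E _]]|[L _]]; lra. Qed.

(** With [c = alpha / beta], each factor in the argument of the polynomial is [sqrt beta] times a
    shifted variable, and [beta x y - alpha (x + y) = beta (x - c) (y - c) - alpha^2 / beta]. *)
Lemma kern_shift (x y : nonnegreal) :
  K x y = exp (- (alpha ^ 2 / beta)) *
    (sum_n (fun l => a l * (beta * (x - c) * (y - c)) ^ l) (degree a d)
     * exp (beta * (x - c) * (y - c))).
Proof.
  pose proof (cond_pos beta) as Hb.
  assert (Hs : sqrt beta <> 0) by (apply Rgt_not_eq, sqrt_lt_R0, Hb).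
  assert (Hss : sqrt beta * sqrt beta = beta) by (apply sqrt_sqrt; lra).
  unfold kern.
  replace ((sqrt beta * x - alpha / sqrt beta) * (sqrt beta * y - alpha / sqrt beta))
    with (beta * (x - c) * (y - c)).
  2: { replace (alpha / sqrt beta) with (sqrt beta * c).
       - rewrite <- Hss at 1; ring.
       - rewrite <- Hss at 2; field; exact Hs. }
  rewrite poly_degree, (Rmult_comm (exp _)), (Rmult_assoc (sum_n _ _)), <- exp_plus.
  do 2 f_equal; field; lra.
Qed.

Lemma is_series_kern (x y : nonnegreal) :
  is_series (fun k => kernel_coef k * (x - c) ^ k * (y - c) ^ k) (K x y).
Proof.
  rewrite kern_shift.
  eapply is_series_ext; [|apply is_series_Rscal, is_series_poly_mult_exp].
  intro k; unfold kernel_coef, hcoef; simpl; rewrite !Rpow_mult_distr.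
  field; apply INR_fact_neq_0.
Qed.

Lemma kern_sym (x y : nonnegreal) : K x y = K y x.
Proof.
  rewrite !kern_shift; replace (beta * (x - c) * (y - c)) with (beta * (y - c) * (x - c)).
  - reflexivity.
  - ring.
Qed.

Lemma kernel_coef_nonneg (k : nat) : 0 <= kernel_coef k.
Proof.
  apply Rmult_le_pos; [apply hcoef_nonneg|].
  apply Rdiv_le_0_compat; [left; apply pow_lt, cond_pos|apply INR_fact_lt_0].
Qed.

Lemma kernel_function_kern : kernel_function K.
Proof.
  split; [exact kern_sym|].
  intros n x _ v.
  (* The expansion is diagonal, so the quadratic form is the sum of [kernel_coef k * p k ^ 2]. *)
  set (p := fun k => sum_n (fun i => v i * (x i - c) ^ k) n).
  assert (H : is_series (fun k => kernel_coef k * p k ^ 2)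
     (sum_n (fun i => sum_n (fun j => v i * K (x i) (x j) * v j) n) n)).
  { eapply is_series_ext; [|apply is_series_sum_n; intro i; apply is_series_sum_n; intro j].
    2: { rewrite Rmult_assoc, (Rmult_comm (K _ _)), <- Rmult_assoc.
         apply is_series_Rscal, is_series_kern. }
    intro k; cbv beta.
    replace (kernel_coef k * p k ^ 2) with (kernel_coef k * p k * p k) by ring.
    unfold p at 2; rewrite <- sum_n_Rmult_l; apply sum_n_Rext; intro i.
    replace (kernel_coef k * p k * (v i * (x i - c) ^ k))
      with (kernel_coef k * (v i * (x i - c) ^ k) * p k) by ring.
    unfold p; rewrite <- sum_n_Rmult_l; apply sum_n_Rext; intro j; ring_R. }
  rewrite <- (is_series_unique _ _ H); apply Series_nonneg.
  - intro k; apply Rmult_le_pos; [apply kernel_coef_nonneg|apply pow2_ge_0].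
  - eexists; exact H.
Qed.

Lemma exp_poly_space_kern (y : nonnegreal) :
  exp_poly_space (degree a d) c (beta * (y - c)) (fun x => K y x).
Proof.
  (* The exponent [beta (y - c) (x - c)] is split into a part linear in [x] and a constant, which is
     absorbed into the coefficients. *)
  exists (fun l => exp (- (alpha ^ 2 / beta)) * (a l * (beta * (y - c)) ^ l)
                   * exp (- (beta * (y - c) * c))).
  intro x; rewrite kern_shift, <- Rmult_assoc, <- sum_n_Rmult_l.
  replace (beta * (y - c) * (x - c)) with (- (beta * (y - c) * c) + beta * (y - c) * x)
    by ring.
  rewrite exp_plus, <- Rmult_assoc, <- sum_n_Rmult_r; f_equal.
  apply sum_n_Rext; intro l.
  replace (- (beta * (y - c) * c) + beta * (y - c) * x)
    with (beta * (y - c) * (x - c)) by ring.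
  rewrite (Rpow_mult_distr (beta * (y - c))); ring_R.
Qed.

Lemma fully_consistent_kern : fully_consistent K.
Proof.
  split; [exact kernel_function_kern|].
  assert (H : forall ys : list nonnegreal, exists V, derivation_closed V /\
            forall y, In y ys -> V (fun x => K y x)).
  { induction ys as [|y ys [V [HV IH]]].
    (* Without points any closed space serves; this one consists of the constants. *)
    - exists (exp_poly_space 0 0 0); split; [apply derivation_closed_exp_poly|].
      intros y [].
    - pose proof (derivation_closed_exp_poly (degree a d) c (beta * (y - c))) as HW.
      eexists; split; [apply derivation_closed_sum; [exact HW|exact HV]|].
      intros z [<-|Hz].
      + apply sum_space_l; [apply HV|apply exp_poly_space_kern].
      + apply sum_space_r; [apply HW|auto]. }
  intro ys; destruct (H ys) as [V [[F [C D]] HV]]; exists V; auto.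
Qed.

(** * The Hilbert space *)

Notation H := (Hspace a d alpha beta).
Notation ip := (Hip a d alpha beta).
Notation b := (taylor_coef alpha beta).

(** The support condition turns the weighted seminorm into a norm. *)
Definition coef_space (q : nat -> R) : Prop :=
  (forall k, W k = 0 -> q k = 0) /\ l2_finite W q.

Lemma taylor_coef_expansion (f : nonnegreal -> R) (q : nat -> R) :
  expansion c f q -> forall k, b f k = q k.
Proof.
  intros Hf k; unfold taylor_coef.
  rewrite (Derive_n_nonneg_expansion (center alpha beta) f q Hf).
  field; apply INR_fact_neq_0.
Qed.

Lemma Derive_n_taylor_coef (f : nonnegreal -> R) (k : nat) :
  Derive_n_nonneg k f (center alpha beta) = b f k * INR (fact k).
Proof. unfold taylor_coef; field; apply INR_fact_neq_0. Qed.

Lemma Hip_term_taylor (f g : nonnegreal -> R) (k : nat) :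
  Hip_term a d alpha beta f g k = W k * b f k * b g k.
Proof.
  unfold Hip_term, norm_weight; rewrite !Derive_n_taylor_coef; field.
  split; [apply pow_nonzero, Rgt_not_eq, cond_pos|apply INR_fact_neq_0].
Qed.

Lemma Hnorm2_term_taylor (f : nonnegreal -> R) (k : nat) :
  Hnorm2_term a d alpha beta f k = W k * b f k ^ 2.
Proof.
  unfold Hnorm2_term, norm_weight; rewrite pow2_abs, Derive_n_taylor_coef; field.
  split; [apply pow_nonzero, Rgt_not_eq, cond_pos|apply INR_fact_neq_0].
Qed.

Lemma Hspace_coef (f : nonnegreal -> R) : H f -> expansion c f (b f) /\ coef_space (b f).
Proof.
  intros [Hf [_ Hn]].
  (* The series defining membership has coefficients [ind k * b f k]; uniqueness of Taylor
     coefficients forces [b f] to vanish where [ind] does. *)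
  assert (E : forall k, b f k = Defs.ind a d alpha beta k * b f k)
    by exact (taylor_coef_expansion f _ Hf).
  split; [|split].
  - intro x; apply is_series_ext with (2 := Hf x).
    intro k; rewrite <- E; reflexivity.
  - intros k Wk; rewrite E.
    destruct (norm_weight_cases k) as [[_ [_ [_ E0]]]|[L _]]; [rewrite E0; ring|lra].
  - exact (ex_series_ext _ _ (Hnorm2_term_taylor f) Hn).
Qed.

Lemma Hspace_intro (f : nonnegreal -> R) (q : nat -> R) :
  expansion c f q -> coef_space q -> H f.
Proof.
  intros Hf [Hsupp Hl2]; pose proof (taylor_coef_expansion f q Hf) as E.
  assert (Hl2' : l2_finite W (b f)).
  { apply l2_finite_ext with q; [intro; symmetry; apply E|exact Hl2]. }
  split; [|split].
  - intro x; apply is_series_ext with (2 := Hf x); intro k; rewrite E.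
    destruct (norm_weight_cases k) as [[_ [W0 _]]|[_ [_ E1]]].
    + rewrite (Hsupp k W0); ring_R.
    + rewrite E1; ring_R.
  (* Here [weight] is [beta^k / k!] times [norm_weight], and [beta^k / k!] is one term of the series
     of [exp beta]. Finite norm thus gives the weighted summability clause. *)
  - apply ex_series_Rle with (fun k => exp beta * (W k * b f k ^ 2)).
    2: { exact (ex_series_scal (exp beta) _ Hl2'). }
    intro k.
    assert (Hw : 0 <= weight a d alpha beta k).
    { unfold weight; destruct (Rlt_dec 0 (h k)); [|lra].
      left; apply Rinv_0_lt_compat; assumption. }
    rewrite pow2_abs, Rabs_pos_eq by (apply Rmult_le_pos; [exact Hw|apply pow2_ge_0]).
    assert (L : beta ^ k / INR (fact k) <= exp beta).
    { rewrite <- (is_series_unique _ _ (is_series_exp beta)).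
      apply (term_le_Series (fun k => beta ^ k / INR (fact k))).
      - intro n; apply Rdiv_le_0_compat; [left; apply pow_lt, cond_pos|apply INR_fact_lt_0].
      - eexists; apply is_series_exp. }
    replace (weight a d alpha beta k) with (beta ^ k / INR (fact k) * W k).
    + rewrite Rmult_assoc; apply Rmult_le_compat_r; [|exact L].
      apply l2_term_pos, norm_weight_nonneg.
    + unfold norm_weight; field.
      split; [apply pow_nonzero, Rgt_not_eq, cond_pos|apply INR_fact_neq_0].
  - apply ex_series_ext with (2 := Hl2'); intro k; symmetry; apply Hnorm2_term_taylor.
Qed.

Lemma is_series_Hip (f g : nonnegreal -> R) :
  H f -> H g -> is_series (Hip_term a d alpha beta f g) (ip f g).
Proof.
  intros Hf Hg; apply Series_correct.
  eapply ex_series_ext; [intro k; symmetry; apply Hip_term_taylor|].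
  apply ex_series_l2_prod; [exact norm_weight_nonneg|apply Hspace_coef, Hf|apply Hspace_coef, Hg].
Qed.

Lemma Hip_taylor (f g : nonnegreal -> R) : ip f g = Series (fun k => W k * b f k * b g k).
Proof. apply Series_ext, Hip_term_taylor. Qed.

Lemma expansion_plus (f g : nonnegreal -> R) (q r : nat -> R) :
  expansion c f q -> expansion c g r ->
  expansion c (fun x => f x + g x) (fun k => q k + r k).
Proof.
  intros Hf Hg x.
  apply is_series_ext with (2 := is_series_Rplus _ _ _ _ (Hf x) (Hg x)); intro k.
  ring_R.
Qed.

Lemma expansion_scal (t : R) (f : nonnegreal -> R) (q : nat -> R) :
  expansion c f q -> expansion c (fun x => t * f x) (fun k => t * q k).
Proof.
  intros Hf x.
  apply is_series_ext with (2 := is_series_Rscal t _ _ (Hf x)); intro k; ring_R.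
Qed.

Lemma coef_space_plus (q r : nat -> R) :
  coef_space q -> coef_space r -> coef_space (fun k => q k + r k).
Proof.
  intros [Sq Lq] [Sr Lr]; split.
  - intros k Wk; rewrite Sq, Sr by exact Wk; ring.
  - apply l2_finite_plus; [exact norm_weight_nonneg|exact Lq|exact Lr].
Qed.

Lemma coef_space_scal (t : R) (q : nat -> R) :
  coef_space q -> coef_space (fun k => t * q k).
Proof.
  intros [Sq Lq]; split; [|apply l2_finite_scal, Lq].
  intros k Wk; rewrite Sq by exact Wk; ring.
Qed.

Lemma taylor_coef_plus (f g : nonnegreal -> R) (k : nat) :
  H f -> H g -> b (fun x => f x + g x) k = b f k + b g k.
Proof.
  intros Hf Hg; apply (taylor_coef_expansion _ (fun k => b f k + b g k)).
  apply expansion_plus; apply Hspace_coef; assumption.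
Qed.

Lemma taylor_coef_scal (t : R) (f : nonnegreal -> R) (k : nat) :
  H f -> b (fun x => t * f x) k = t * b f k.
Proof.
  intro Hf; apply (taylor_coef_expansion _ (fun k => t * b f k)).
  apply expansion_scal, Hspace_coef, Hf.
Qed.

Lemma linear_subspace_Hspace : linear_subspace H.
Proof.
  split; [|split].
  (* The zero sequence is written as a multiple so that [l2_finite_scal] applies. *)
  - apply Hspace_intro with (fun _ => 0 * 0).
    + intro x; rewrite <- (Rmult_0_l (exp 0)).
      apply is_series_ext with (2 := is_series_Rscal 0 _ _ (is_series_exp 0)).
      intro k; ring_R.
    + split; [intros; ring|].
      apply l2_finite_scal; exists (exp 0 * 0).
      rewrite Rmult_comm; apply is_series_ext with (2 := is_series_Rscal 0 _ _ (is_series_exp 0)).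
      intro k; ring_R.
  - intros f g Hf Hg; apply Hspace_coef in Hf; apply Hspace_coef in Hg.
    eapply Hspace_intro;
      [apply expansion_plus; [apply Hf|apply Hg]|apply coef_space_plus; [apply Hf|apply Hg]].
  - intros t f Hf; apply Hspace_coef in Hf.
    eapply Hspace_intro; [apply expansion_scal, Hf|apply coef_space_scal, Hf].
Qed.

Lemma inner_product_Hip : inner_product_on H ip.
Proof.
  destruct linear_subspace_Hspace as [_ [H_plus H_scal]].
  split; [|split; [|split; [|split]]].
  - intros f g _ _; apply Series_ext; intro k; unfold Hip_term; ring.
  - intros f g e Hf Hg He; apply is_series_unique.
    apply is_series_ext with
      (2 := is_series_Rplus _ _ _ _ (is_series_Hip f e Hf He) (is_series_Hip g e Hg He)).
    intro k; rewrite !Hip_term_taylor, taylor_coef_plus by assumption; ring_R.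
  - intros t f g Hf Hg; apply is_series_unique.
    apply is_series_ext with (2 := is_series_Rscal t _ _ (is_series_Hip f g Hf Hg)).
    intro k; rewrite !Hip_term_taylor, taylor_coef_scal by assumption; ring_R.
  - intros f Hf; apply Series_nonneg; [|eexists; apply is_series_Hip; assumption].
    intro k; rewrite Hip_term_taylor, Rmult_assoc.
    pose proof (norm_weight_nonneg k); apply Rmult_le_pos; [assumption|nra].
  - intros f Hf E x; destruct (Hspace_coef f Hf) as [Ef [Sf Lf]].
    rewrite Hip_taylor in E.
    rewrite (Series_ext _ (fun k => W k * b f k ^ 2)) in E by (intro; ring).
    (* Each nonnegative term is at most the sum, which is 0; where the weight vanishes, the support
       condition takes over. *)
    assert (Z : forall k, b f k = 0).
    { intro k; pose proof (term_le_Series _ k (l2_term_pos W norm_weight_nonneg (b f)) Lf) as T.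
      simpl in T; destruct (Req_dec (W k) 0) as [W0|W0]; [apply Sf, W0|].
      pose proof (norm_weight_nonneg k).
      destruct (Req_dec (b f k) 0) as [|N]; [assumption|exfalso].
      assert (0 < W k * (b f k * (b f k * 1))); [|simpl in E; lra].
      apply Rmult_lt_0_compat; [lra|nra]. }
    rewrite <- (is_series_unique _ _ (Ef x)).
    rewrite (Series_ext _ (fun k => 0 * 0)) by (intro k; rewrite Z; ring).
    rewrite Series_scal_l; ring.
Qed.

(** * Kernel sections, reproducing property and completeness *)

Lemma coef_space_kern (x : nonnegreal) : coef_space (fun k => kernel_coef k * (x - c) ^ k).
Proof.
  split.
  - intros k Wk; destruct (norm_weight_cases k) as [[_ [_ [E _]]]|[L _]]; [rewrite E; ring|lra].
  (* Since [W k * kernel_coef k ^ 2 = kernel_coef k], the squared norm of the section at [x] is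
     [K x x]. *)
  - exists (K x x); apply is_series_ext with (2 := is_series_kern x x); intro k.
    destruct (norm_weight_cases k) as [[_ [_ [E _]]]|[_ [E _]]]; [rewrite E; ring_R|].
    rewrite <- (Rmult_1_l (kernel_coef k * _ * _)), <- E; ring_R.
Qed.

Lemma expansion_kern (x : nonnegreal) :
  expansion c (fun y => K y x) (fun k => kernel_coef k * (x - c) ^ k).
Proof.
  intro y; apply is_series_ext with (2 := is_series_kern y x); intro k; ring_R.
Qed.

Lemma norm_weight_kernel_coef (q : nat -> R) (s : R) (k : nat) :
  (forall k, W k = 0 -> q k = 0) -> W k * q k * (kernel_coef k * s) = q k * s.
Proof.
  intro Sq; destruct (norm_weight_cases k) as [[_ [E _]]|[_ [E _]]].
  - rewrite (Sq k E); ring.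
  - rewrite <- (Rmult_1_l (q k * s)), <- E; ring.
Qed.

Lemma reproducing_kern : is_reproducing_kernel H ip K.
Proof.
  split; [intro x; exact (Hspace_intro _ _ (expansion_kern x) (coef_space_kern x))|].
  intros f x Hf; destruct (Hspace_coef f Hf) as [Ef [Sf Lf]].
  rewrite Hip_taylor, <- (is_series_unique _ _ (Ef x)); apply Series_ext; intro k.
  rewrite (taylor_coef_expansion _ _ (expansion_kern x)).
  symmetry; apply norm_weight_kernel_coef, Sf.
Qed.

(** The terms of the power series are those of the weighted product of [q] with a kernel section,
    and both are square-summable. *)
Lemma coef_space_expansion (q : nat -> R) :
  coef_space q -> expansion c (fun x => Series (fun k => q k * (x - c) ^ k)) q.
Proof.
  intros [Sq Lq] x; apply Series_correct.
  eapply ex_series_ext; [intro k; apply norm_weight_kernel_coef, Sq|].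
  apply (ex_series_l2_prod W norm_weight_nonneg q (fun k => kernel_coef k * (x - c) ^ k)).
  - exact Lq.
  - apply coef_space_kern.
Qed.

Lemma induced_norm_coef (f g : nonnegreal -> R) :
  H f -> H g ->
  induced_norm ip (fun x => f x - g x) = sqrt (Series (fun k => W k * (b f k - b g k) ^ 2)).
Proof.
  intros Hf Hg; unfold induced_norm; rewrite Hip_taylor; f_equal.
  apply Series_ext; intro k.
  rewrite (taylor_coef_expansion _ (fun k => b f k + -1 * b g k)); [ring|].
  intro x; replace (f x - g x) with (f x + -1 * g x) by ring; revert x.
  apply (expansion_plus f (fun x => -1 * g x) (b f) (fun k => -1 * b g k));
    [|apply expansion_scal]; apply Hspace_coef; assumption.
Qed.

Lemma complete_Hspace : complete_for H ip.
Proof.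
  intros u Hu Hcauchy.
  destruct (l2_complete W norm_weight_nonneg (fun n => b (u n))) as [q [Lq [Sq Hq]]].
  - intro n; apply Hspace_coef, Hu.
  - intros n k; apply Hspace_coef, Hu.
  (* [l2_complete] measures squared norms, hence the square root. *)
  - intros eps Heps; destruct (Hcauchy (sqrt eps) (sqrt_lt_R0 _ Heps)) as [N HN].
    exists N; intros n m Hn Hm; specialize (HN n m Hn Hm).
    rewrite induced_norm_coef in HN by apply Hu.
    left; apply sqrt_lt_0_alt, HN.
  - set (f := fun x : nonnegreal => Series (fun k => q k * (x - c) ^ k)).
    assert (Ef : expansion c f q) by (apply coef_space_expansion; split; assumption).
    assert (Hf : H f) by (apply Hspace_intro with q; [exact Ef|split; assumption]).
    exists f; split; [exact Hf|].
    (* Halving turns the weak bound of [l2_complete] into a strict one. *)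
    intros eps Heps; destruct (Hq ((eps / 2) ^ 2)) as [N HN]; [apply pow_lt; lra|].
    exists N; intros n Hn; specialize (HN n Hn).
    rewrite induced_norm_coef by (try apply Hu; exact Hf).
    rewrite (Series_ext _ (fun k => W k * (b (u n) k - q k) ^ 2))
      by (intro k; rewrite (taylor_coef_expansion f q Ef); reflexivity).
    apply sqrt_le_1_alt in HN; rewrite sqrt_pow2 in HN by lra; lra.
Qed.

End Kernel.

(** * Cauchy-Schwarz, bounded evaluations and the final assembly *)

Lemma Cauchy_Schwarz_on {X : Type} (H : (X -> R) -> Prop) (ip : (X -> R) -> (X -> R) -> R) :
  linear_subspace H -> inner_product_on H ip -> forall f g, H f -> H g ->
  Rabs (ip f g) <= induced_norm ip f * induced_norm ip g.
Proof.
  intros [_ [H_plus H_scal]] [sym [add [scal [pos _]]]] f g Hf Hg.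
  assert (Q : forall s t, 0 <= s ^ 2 * ip f f + 2 * (s * t) * ip f g + t ^ 2 * ip g g).
  { intros s t.
    assert (Hs := H_scal s f Hf); assert (Ht := H_scal t g Hg).
    pose proof (pos _ (H_plus _ _ Hs Ht)) as P.
    rewrite add, !(sym _ (fun x => s * f x + t * g x)), !add, !scal in P; auto.
    rewrite (sym f (fun x => s * f x)), (sym f (fun x => t * g x)),
      (sym g (fun x => s * f x)), (sym g (fun x => t * g x)), !scal, (sym g f) in P; auto.
    nra. }
  unfold induced_norm; rewrite <- sqrt_mult by auto.
  rewrite <- sqrt_Rsqr_abs; apply sqrt_le_1_alt; unfold Rsqr.
  pose proof (pos f Hf) as Pf; pose proof (pos g Hg) as Pg.
  destruct (Req_dec (ip g g) 0) as [Z|Z].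
  (* With [ip g g = 0] this choice yields [0 <= - (ip f g) ^ 2 * (ip f f + 2)], so [ip f g = 0]. *)
  - pose proof (Q (ip f g) (- (ip f f + 1))) as Q1; rewrite Z in *.
    nra.
  (* This choice yields [0 <= ip g g * (ip f f * ip g g - (ip f g) ^ 2)]. *)
  - pose proof (Q (ip g g) (- ip f g)) as Q1.
    apply Rmult_le_reg_l with (ip g g); [lra|]; nra.
Qed.

Theorem proposition3p8 :
  forall (d : nat) (a : nat -> R) (alpha : nonnegreal) (beta : posreal),
    (forall k, (k <= d)%nat -> 0 <= a k) ->
    fully_consistent (kern a d alpha beta) /\
    is_RKHS (Hspace a d alpha beta) (Hip a d alpha beta) /\
    is_reproducing_kernel (Hspace a d alpha beta) (Hip a d alpha beta)
      (kern a d alpha beta) /\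
    (forall f g, Hspace a d alpha beta f -> Hspace a d alpha beta g ->
       is_series (Hip_term a d alpha beta f g) (Hip a d alpha beta f g)) /\
    (forall f, Hspace a d alpha beta f ->
       is_series (Hnorm2_term a d alpha beta f)
         (induced_norm (Hip a d alpha beta) f ^ 2)).
Proof.
  intros d a alpha beta a_pos.
  pose proof (linear_subspace_Hspace a d alpha beta a_pos) as HL.
  pose proof (inner_product_Hip a d alpha beta a_pos) as HI.
  destruct (reproducing_kern a d alpha beta a_pos) as [HK HR].
  split; [exact (fully_consistent_kern a d alpha beta a_pos)|].
  split; [|split; [split; assumption|split]].
  - split; [exact HL|split; [exact HI|split]].
    + exact (complete_Hspace a d alpha beta a_pos).
    (* Evaluation at [x] is the product with the kernel section, so the bound is the norm of that
       section. *)
    + intro x; eexists; intros f Hf; rewrite (HR f x Hf) at 1.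
      rewrite Rmult_comm; exact (Cauchy_Schwarz_on _ _ HL HI _ _ Hf (HK x)).
  - exact (is_series_Hip a d alpha beta a_pos).
  - intros f Hf; unfold induced_norm; rewrite pow2_sqrt by (apply HI, Hf).
    eapply is_series_ext; [|exact (is_series_Hip a d alpha beta a_pos f f Hf Hf)].
    intro k; rewrite Hip_term_taylor, Hnorm2_term_taylor; simpl; ring_R.
Qed.
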